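(* Let $\kappa:[0,1]\to\mathbb R$ be continuous, nondecreasing and concave with $\kappa(0)=0$ and $\kappa(1)=1$. Every $\sigma\in M^+_\kappa(\mathbb T)$ has a unique extension $\tilde\sigma$ to a $\kappa$-thin measure $\tilde\sigma\ge0$ on $\mathbb T$. The measure $\tilde\sigma$ is finite if and only if there is a constant $c\ge0$ with $\sigma(F)\le c$ for all $F\in\mathcal F_\kappa$. In this case we have $\tilde\sigma(\mathbb T)\le c$. The restriction of a $\kappa$-thin measure $\tilde\sigma$ on $\mathcal B(\mathbb T)$ to $\mathcal B_\kappa$ defines a $\kappa$-singular measure $\sigma=\tilde\sigma|_{\mathcal B_\kappa}$ in $M^+_\kappa(\mathbb T)$.
   Context: $\mathbb T$ is the unit circle, $\lambda$ its Haar probability measure, $|I|=\lambda(I)$ for arcs $I$, $\mathcal B(X)$ the Borel algebra of $X$. The $\kappa$-entropy of a finite set $\emptyset\ne E\subset\mathbb T$ is $\kappa(E)=\sum_I\kappa(|I|)$, the sum over the connected components $I$ of $\mathbb T\setminus E$; $\kappa(\emptyset)=0$; for a closed set $\emptyset\ne E\subset\mathbb T$, $\kappa(E)=\sup\{\kappa(E_1):E_1\subset E\text{ finite}\}\in[1,\infty]$. A $\kappa$-Carleson set is a closed $E\subset\mathbb T$ with $\lambda(E)=0$ and $\kappa(E)<\infty$; $\mathcal F_\kappa$ is the set of $\kappa$-Carleson sets and $\mathcal B_\kappa$ the set of Borel sets $B\subset\mathbb T$ whose closure is in $\mathcal F_\kappa$ (i.e. the union of the Borel algebras $\mathcal B(E)$,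 $E\in\mathcal F_\kappa$). A $\kappa$-singular measure is a function $\sigma:\mathcal B_\kappa\to\mathbb R$ such that (1) $\sigma^E:=\sigma|_{\mathcal B(E)}$ is a finite real measure on $\mathcal B(E)$ for every $E\in\mathcal F_\kappa$, and (2) there is $c_\sigma\ge0$ with $|\sigma(F)|\le c_\sigma\kappa(F)$ for all $F\in\mathcal F_\kappa$. $M^+_\kappa(\mathbb T)$ is the set of $\kappa$-singular measures $\sigma$ with $\sigma^E\ge0$ for all $E\in\mathcal F_\kappa$. A possibly infinite positive measure $\tilde\sigma\ge0$ on $\mathcal B(\mathbb T)$ is called $\kappa$-thin if (i) there is a sequence $F_1\subset F_2\subset\cdots$ in $\mathcal F_\kappa$ with $\tilde\sigma(B)=\lim_{\nu\to\infty}\tilde\sigma(B\cap F_\nu)$ for every Borel set $B\subset\mathbb T$, and (ii) there is $c\ge0$ with $\tilde\sigma(F)\le c\,\kappa(F)$ for all $F\in\mathcal F_\kappa$. *)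

(* Defs.v *)
From HB Require Import structures.
From mathcomp Require Import all_boot all_order all_algebra.
From mathcomp Require Import all_classical all_reals all_analysis.

Set Implicit Arguments.
Unset Strict Implicit.
Unset Printing Implicit Defensive.

Import Order.TTheory GRing.Theory Num.Theory.
Import numFieldNormedType.Exports.

Local Open Scope classical_set_scope.
Local Open Scope ring_scope.
Local Open Scope ereal_scope.

Section circle.
Context {R : realType}.

Definition unit_circle : set (R * R) := [set z | z.1 ^+ 2 + z.2 ^+ 2 = 1]%R.

Lemma exp2pi_subproof (t : R) :
  (cos (2 * pi * t), sin (2 * pi * t))%R \in unit_circle.
Proof. by rewrite inE; exact: cos2Dsin2. Qed.

End circle.

Definition circle (R : realType) : Type := set_type (@unit_circle R).

(* [t |-> e^(2 i pi t)] *)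
Definition exp2pi {R : realType} (t : R) : circle R :=
  exist (fun z => z \in unit_circle) _ (exp2pi_subproof t).

(* The pseudometric structure is the one induced by the plane; in particular
   the topology is the subspace topology. *)
HB.instance Definition _ (R : realType) :=
  PseudoMetric.copy (circle R) (set_type (@unit_circle R)).
HB.instance Definition _ (R : realType) :=
  isPointed.Build (circle R) (exp2pi 0%R).

HB.instance Definition _ (R : realType) :=
  Measurable.copy (circle R) (g_sigma_algebraType (@open (circle R))).

Definition borel {R : realType} : set (set (circle R)) :=
  (@open (circle R)).-sigma.-measurable.

Section kappa_entropy.
Context {R : realType}.
Local Notation T := (circle R).

(* Normalized Haar measure, as the image of Lebesgue measure on [0, 1[ *)
Definition haar (A : set T) : \bar R :=
  lebesgue_measure (`[0%R, 1%R[ `&` exp2pi @^-1` A).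

Definition components (A : set T) : set (set T) :=
  [set connected_component A x | x in A].

(* Only the values of [kappa] on [0, 1] matter. *)
Variable kappa : R -> R.

Definition finite_entropy (E : set T) : \bar R :=
  if E == set0 then 0
  else \esum_(I in components (~` E)) (kappa (fine (haar I)))%:E.

(* [F = set0] is allowed in the supremum: its contribution is 0, which gives
   [entropy set0 = 0] and does not affect nonempty [E]. *)
Definition entropy (E : set T) : \bar R :=
  ereal_sup [set finite_entropy F | F in [set F | finite_set F /\ F `<=` E]].

Definition carleson : set (set T) :=
  [set E | [/\ closed E, haar E = 0 & entropy E < +oo]].

Definition carleson_borel : set (set T) :=
  [set B | borel B /\ carleson (closure B)].

(* A function on [carleson_borel] is represented by a total function on sets,
   whose values outside [carleson_borel] are never used. *)
Definition finite_real_measure_on (sigma : set T -> R) (E : set T) : Prop :=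
  sigma set0 = 0%R /\
  forall A : nat -> set T,
    (forall n, borel (A n)) -> (forall n, A n `<=` E) -> trivIset setT A ->
    (fun n => \sum_(0 <= i < n) sigma (A i))%R @ \oo -->
      sigma (\bigcup_n A n).

Definition singular_measure (sigma : set T -> R) : Prop :=
  (forall E, carleson E -> finite_real_measure_on sigma E) /\
  (exists2 c : R, (0 <= c)%R &
    forall F, carleson F -> `|sigma F|%:E <= c%:E * entropy F).

Definition pos_singular_measure (sigma : set T -> R) : Prop :=
  singular_measure sigma /\
  forall E B, carleson E -> borel B -> B `<=` E -> (0 <= sigma B)%R.

Definition thin_measure (mu : {measure set T -> \bar R}) : Prop :=
  (exists F : nat -> set T,
    [/\ forall n, carleson (F n),
        forall n, F n `<=` F n.+1 &
        forall B, borel B -> mu (B `&` F n) @[n --> \oo] --> mu B]) /\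
  (exists2 c : R, (0 <= c)%R &
    forall F, carleson F -> mu F <= c%:E * entropy F).

Definition extends (mu : set T -> \bar R) (sigma : set T -> R) : Prop :=
  forall B, carleson_borel B -> mu B = (sigma B)%:E.

End kappa_entropy.

(* Main.v *)
Require Import Defs.
From HB Require Import structures.
From mathcomp Require Import all_boot all_order all_algebra.
From mathcomp Require Import finmap lra ring.
From mathcomp Require Import all_classical all_reals all_analysis.

Import Order.TTheory GRing.Theory Num.Theory.
Import numFieldNormedType.Exports.

Local Open Scope classical_set_scope.
Local Open Scope ring_scope.

(* Entropy is submodular: inserting a point into a finite set splits a gap of
   length [g + h] and adds [kappa g + kappa h - kappa (g + h)], which by concavity
   increases with [g] and [h], while gaps shrink as the set grows.

   Let [P n] be the set of [n.+1]-th roots of unity. Since [kappa] is continuous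
   at 0, adding a Carleson set [F] to [P n] raises the entropy by an amount that
   tends to 0 with [n]. If [U n] nearly maximizes [sigma F - c * entropy (F u P n)],
   which is nonpositive, then comparing [U n] with [F u U n] and using
   submodularity bounds [sigma (F \ U n)] by [c] times that amount, up to a small
   error. So all of [sigma] is carried by the countable union of the [U n], and
   the extension is obtained by summing [sigma] over the disjoint pieces of this
   union. Two thin extensions agree because each is a limit of its values on
   Carleson sets. *)

Set Implicit Arguments.
Unset Strict Implicit.

(** * Angular coordinate on the circle *)

Section circle_coordinates.
Context {R : realType}.
Local Notation T := (circle R).
Implicit Types (x y z p : T) (s t u : R).

Lemma exp2piD1 t : exp2pi (t + 1) = exp2pi t :> T.
Proof.
apply: val_inj => /=; rewrite mulrDr mulr1 mulr_natl.
by rewrite cosD2pi sinD2pi.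
Qed.

(** Equal images give [cos (2 * pi * (s - t)) = 1], so [sin (pi * (s - t))] vanishes, whereas
    [pi * (s - t)] lies strictly between 0 and [pi] when [t < s]. *)
Lemma exp2pi_inj s t : `|s - t| < 1 -> exp2pi s = exp2pi t :> T -> s = t.
Proof.
wlog st : s t / t <= s.
  move=> h; case: (leP t s) => [/h//|ts] d e; apply/esym/h => //; first exact: ltW.
  by rewrite distrC.
rewrite ger0_norm ?subr_ge0// => st1 /(congr1 val) [hc hs].
apply/eqP; rewrite eq_le st andbT leNgt; apply/negP => ts.
have : sin (pi * (s - t)) = 0.
  apply/eqP; rewrite -sqrf_eq0 sin2cos2; apply/eqP.
  have := cosB (2 * pi * s) (2 * pi * t); rewrite hc hs -!expr2 cos2Dsin2.
  have -> : 2 * pi * s - 2 * pi * t = pi * (s - t) + pi * (s - t) by ring.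
  rewrite cosD -!expr2 => h; have := cos2Dsin2 (pi * (s - t)); lra.
apply/eqP; rewrite gt_eqF// sin_gt0_pi//.
have := pi_gt0 R; move=> p0; apply/andP; split; first by apply: mulr_gt0 => //; lra.
by rewrite -[ltRHS]mulr1 ltr_pM2l.
Qed.

Lemma exp2pi_surj z : exists2 t, 0 <= t < 1 & exp2pi t = z.
Proof.
have p0 := pi_gt0 R.
case: z => -[a b] /[dup] + zP; rewrite inE /unit_circle/= => ab.
have a1 : -1 <= a <= 1.
  have := sqr_ge0 b; nra.
have s0 := acos_ge0 a1; have s1 := acos_lepi a1.
have ca : cos (acos a) = a by apply: acosK; rewrite in_itv.
have sa := sin_acos a1.
have sb : Num.sqrt (1 - a ^+ 2) = `|b| by rewrite -ab addrAC subrr add0r sqrtr_sqr.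
have k u : 2 * pi * (u / (2 * pi)) = u by rewrite mulrC divfK// mulf_neq0// gt_eqF.
have kge u : 0 <= u -> 0 <= u / (2 * pi) by move=> u0; apply: divr_ge0 => //; lra.
have klt u : u < 2 * pi -> u / (2 * pi) < 1 by move=> u0; rewrite ltr_pdivrMr; lra.
have kgt u : 0 < u -> 0 < u / (2 * pi) by move=> u0; apply: divr_gt0 => //; lra.
have [b0|b0] := leP 0 b.
  exists (acos a / (2 * pi)); first by apply/andP; split; [exact: kge|apply: klt; lra].
  by apply: val_inj; rewrite /= k ca sa sb ger0_norm.
exists ((2 * pi - acos a) / (2 * pi)).
  apply/andP; split; first by apply: kge; lra.
  apply: klt.
  (* Keeps the angle strictly below a full turn: [acos a = 0] would force [b = 0]. *)
  suff a0 : acos a != 0.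
    by have : 0 < acos a; [rewrite lt_neqAle eq_sym a0|lra].
  apply: contraTneq b0 => h; move: sa; rewrite h sin0 sb => /esym/eqP.
  by rewrite normr_eq0 => /eqP ->; rewrite ltxx.
apply: val_inj; rewrite /= k; congr pair.
  by rewrite addrC mulr_natl cosD2pi cosN.
by rewrite addrC mulr_natl sinD2pi sinN sa sb ltr0_norm// opprK.
Qed.

Definition angle z : R := xget 0 [set t | 0 <= t < 1 /\ exp2pi t = z].

Lemma angleP z : 0 <= angle z < 1 /\ exp2pi (angle z) = z.
Proof.
have [t t01 tz] := exp2pi_surj z.
exact: (@xgetPex _ 0 [set t | 0 <= t < 1 /\ exp2pi t = z] (ex_intro _ t (conj t01 tz))).
Qed.

Lemma angle_itv z : 0 <= angle z < 1.
Proof. by case: (angleP z). Qed.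

Lemma angleK : cancel angle exp2pi.
Proof. by move=> z; case: (angleP z). Qed.

Lemma angle_inj : injective angle.
Proof. exact: can_inj angleK. Qed.

Lemma angle_exp2pi t : 0 <= t < 1 -> angle (exp2pi t) = t.
Proof.
move=> t01; have := angle_itv (exp2pi t) => a01.
by apply: exp2pi_inj; [rewrite ltr_norml; lra|exact: angleK].
Qed.

(* Counterclockwise distance in turns; a full turn, not 0, when [x = y]. *)
Definition ccw x y : R :=
  if angle x < angle y then angle y - angle x else angle y - angle x + 1.

Lemma ccw_itv x y : 0 < ccw x y <= 1.
Proof.
have := angle_itv x; have := angle_itv y; rewrite /ccw; case: ifPn; rewrite -?leNgt; lra.
Qed.

Lemma ccwxx x : ccw x x = 1.
Proof. by rewrite /ccw ltxx subrr add0r. Qed.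

Lemma exp2pi_ccw x y : exp2pi (angle x + ccw x y) = y.
Proof.
rewrite /ccw; case: ifP => _; first by rewrite addrC subrK angleK.
by rewrite addrA exp2piD1 addrC subrK angleK.
Qed.

(** Both sides lie in []0, 1]], so they differ by less than a turn and [exp2pi_inj] applies. *)
Lemma ccw_exp2pi x u : 0 < u <= 1 -> ccw x (exp2pi (angle x + u)) = u.
Proof.
move=> u01; have h := ccw_itv x (exp2pi (angle x + u)).
apply: (addrI (angle x)); apply: exp2pi_inj; last exact: exp2pi_ccw.
by rewrite ltr_norml; lra.
Qed.

Lemma ccw_injr x y z : ccw x y = ccw x z -> y = z.
Proof. by move=> h; rewrite -(exp2pi_ccw x y) h exp2pi_ccw. Qed.

Lemma ccw_injl x y z : ccw x z = ccw y z -> x = y.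
Proof.
have := angle_itv x; have := angle_itv y; have := angle_itv z => a b c.
move=> h; apply: angle_inj; move: h; rewrite /ccw.
by case: ifPn; case: ifPn; rewrite -?leNgt; lra.
Qed.

(** The hypothesis says that [y] is met strictly before [z] on the way from [x]; [ccw_transl]
    expresses this by the distances to [z] instead. *)
Lemma ccw_trans x y z : ccw x y < ccw x z -> ccw x z = ccw x y + ccw y z.
Proof.
have := angle_itv x; have := angle_itv y; have := angle_itv z => a b c.
by rewrite /ccw; do 3 (case: ifPn; rewrite -?leNgt); lra.
Qed.

Lemma ccw_transl x y z : ccw y z < ccw x z -> ccw x z = ccw x y + ccw y z.
Proof.
have := angle_itv x; have := angle_itv y; have := angle_itv z => a b c.
by rewrite /ccw; do 3 (case: ifPn; rewrite -?leNgt); lra.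
Qed.

End circle_coordinates.

(** * Gaps of finite sets *)

Section gaps.
Context {R : realType}.
Local Notation T := (circle R).
Implicit Types (x y z p : T) (A B : {fset T}).
Local Open Scope fset_scope.
Local Open Scope ring_scope.

Lemma bigmin_attained (F : T -> R) A : (forall y, F y <= 1) -> A != fset0 ->
  exists2 y, y \in A & \big[Order.min/1]_(y <- A) F y = F y.
Proof.
move=> F1 /fset0Pn[a aA].
suff h (s : seq T) : a \in s ->
    exists2 y, y \in s & \big[Order.min/1]_(y <- s) F y = F y by exact: h.
elim: s a {aA} => // b s IH a _; have [->|] := eqVneq s [::].
  by exists b; rewrite ?mem_head// big_cons big_nil min_l.
case: s IH => // c s /(_ c (mem_head _ _))[y ys e] _; rewrite big_cons e.
have [h|h] := leP (F b) (F y); first by exists b; rewrite ?mem_head.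
by exists y; rewrite // inE ys orbT.
Qed.

(** For [x] in [A], the length of the component of the complement that starts at [x]. The default 1
    is a full turn, in agreement with [ccw x x = 1] for a singleton. *)
Definition gap_after A x : R := \big[Order.min/1]_(y <- A) ccw x y.
Definition gap_before A x : R := \big[Order.min/1]_(y <- A) ccw y x.

Lemma gap_after_le A x y : y \in A -> gap_after A x <= ccw x y.
Proof. by move=> yA; exact: ge_bigmin_seq. Qed.

Lemma gap_before_le A x y : y \in A -> gap_before A x <= ccw y x.
Proof. by move=> yA; exact: (@ge_bigmin_seq _ _ _ _ _ y xpredT (fun y => ccw y x)). Qed.

Lemma gap_afterP A x : A != fset0 -> exists2 y, y \in A & gap_after A x = ccw x y.
Proof. by apply: bigmin_attained => y; case/andP: (ccw_itv x y). Qed.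

Lemma gap_beforeP A x : A != fset0 -> exists2 y, y \in A & gap_before A x = ccw y x.
Proof. by apply: bigmin_attained => y; case/andP: (ccw_itv y x). Qed.

Lemma gap_after_itv A x : 0 < gap_after A x <= 1.
Proof.
rewrite bigmin_le_id andbT; have [->|/(gap_afterP x)[y _ ->]] := eqVneq A fset0.
  by rewrite /gap_after big_seq big_pred0 ?ltr01// => y; rewrite inE.
by case/andP: (ccw_itv x y).
Qed.

Lemma gap_before_itv A x : 0 < gap_before A x <= 1.
Proof.
rewrite bigmin_le_id andbT; have [->|/(gap_beforeP x)[y _ ->]] := eqVneq A fset0.
  by rewrite /gap_before big_seq big_pred0 ?ltr01// => y; rewrite inE.
by case/andP: (ccw_itv y x).
Qed.

Lemma gap_after_anti A B x : B `<=` A -> gap_after A x <= gap_after B x.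
Proof. by move=> /fsubsetP BA; apply: sub_bigmin_seq. Qed.

Lemma gap_before_anti A B x : B `<=` A -> gap_before A x <= gap_before B x.
Proof. by move=> /fsubsetP BA; apply: sub_bigmin_seq. Qed.

Lemma gap_after_setU1 A x z :
  gap_after (z |` A) x = Order.min (ccw x z) (gap_after A x).
Proof.
apply/eqP; rewrite eq_le le_min gap_after_le ?fset1U1// gap_after_anti ?fsubsetU1//=.
have [|y + ->] := @gap_afterP (z |` A) x; first by apply/fset0Pn; exists z; exact: fset1U1.
by rewrite !inE ge_min => /orP[/eqP ->|/(gap_after_le x) ->]; rewrite ?lexx ?orbT.
Qed.

Lemma gap_after_self A z : A != fset0 -> gap_after (z |` A) z = gap_after A z.
Proof.
by move=> A0; rewrite gap_after_setU1 ccwxx min_r//; case/andP: (gap_after_itv A z).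
Qed.

(* [p] is the last point of [A] before [z]. *)
Lemma gap_after_pred A p z : z \notin A -> p \in A -> gap_before A z = ccw p z ->
  gap_after A p = ccw p z + gap_after A z.
Proof.
move=> zA pA pz; have A0 : A != fset0 by apply/fset0Pn; exists p.
(* From [p], the point [z] comes before every point of [A]: an earlier one would be nearer to [z]
   than [p] is. *)
have sh y : y \in A -> ccw p y = ccw p z + ccw z y.
  move=> yA; apply: ccw_trans; rewrite ltNge; apply/negP; rewrite le_eqVlt.
  move=> /orP[/eqP/ccw_injr yz|/ccw_trans h]; first by rewrite -yz yA in zA.
  have := gap_before_le z yA; rewrite pz h; have := ccw_itv p y; lra.
apply/eqP; rewrite eq_le; apply/andP; split.
  by have [y yA ->] := gap_afterP z A0; rewrite -(sh y yA) gap_after_le.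
by have [y yA ->] := gap_afterP p A0; rewrite (sh y yA) lerD2l gap_after_le.
Qed.

(** Seen from [x], the point [p] precedes [z] and already ends the gap, so inserting [z] leaves this
    gap alone. *)
Lemma gap_after_other A p x z : p \in A -> gap_before A z = ccw p z ->
  x \in A -> x != p -> gap_after A x < ccw x z.
Proof.
move=> pA pz xA xp; have : ccw p z < ccw x z.
  rewrite lt_neqAle -{2}pz gap_before_le// andbT.
  by apply: contra xp => /eqP/ccw_injl ->.
move=> /ccw_transl ->; have := gap_after_le x pA; have := ccw_itv p z; lra.
Qed.

Lemma gapD_le1 A z : z \notin A -> A != fset0 -> gap_before A z + gap_after A z <= 1.
Proof.
move=> zA A0; have [p pA h] := gap_beforeP z A0.
by rewrite h -gap_after_pred//; case/andP: (gap_after_itv A p).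
Qed.

Variable kappa : R -> R.

(** Each complementary arc is charged to its starting point; [finite_entropyE] identifies this sum
    with [finite_entropy]. *)
Definition gap_entropy A : R := \sum_(x <- A) kappa (gap_after A x).

(** Only the gap starting at [p], the last point before [z], changes: it is cut at [z], which starts
    the remaining part. *)
Lemma gap_entropyU1 A z : z \notin A -> A != fset0 ->
  gap_entropy (z |` A) = gap_entropy A + (kappa (gap_before A z)
    + kappa (gap_after A z) - kappa (gap_before A z + gap_after A z)).
Proof.
move=> zA A0; have [p pA h] := gap_beforeP z A0.
rewrite /gap_entropy big_fsetU1//= gap_after_self// !(big_fsetD1 p pA)/=.
rewrite h -gap_after_pred//.
have -> : gap_after (z |` A) p = ccw p z.
  rewrite gap_after_setU1 min_l// (gap_after_pred zA)// lerDl.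
  by case/andP: (gap_after_itv A z) => /ltW.
have -> : \sum_(x <- A `\ p) kappa (gap_after (z |` A) x) =
    \sum_(x <- A `\ p) kappa (gap_after A x).
  rewrite big_seq [RHS]big_seq; apply: eq_bigr => x; rewrite !inE => /andP[xp xA].
  by rewrite gap_after_setU1 min_r// ltW// (@gap_after_other A p).
ring.
Qed.

Lemma gap_entropy0 : gap_entropy fset0 = 0.
Proof. by rewrite /gap_entropy big_seq_fset0. Qed.

Lemma gap_entropy1 z : gap_entropy [fset z] = kappa 1.
Proof.
rewrite /gap_entropy big_seq_fset1; have [|y] := @gap_afterP [fset z] z.
  by apply/fset0Pn; exists z; exact: fset11.
by rewrite inE => /eqP -> ->; rewrite ccwxx.
Qed.

End gaps.

(** * Submodularity of the entropy of finite sets *)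

Record gauge (R : realType) (kappa : R -> R) : Prop := Gauge {
  gauge_cont : {within `[0, 1], continuous kappa};
  gauge_nondecr : {in `[0, 1] &, {homo kappa : x y / x <= y}};
  gauge_concave :
    convex_function (`[0, 1]%classic : set R^o) (fun x => - kappa x);
  gauge0 : kappa 0 = 0;
  gauge1 : kappa 1 = 1 }.

Section submodularity.
Context {R : realType}.
Local Notation T := (circle R).
Variable kappa : R -> R.
Hypothesis kg : gauge kappa.
Implicit Types (x y z : T) (A B C : {fset T}).
Local Open Scope fset_scope.
Local Open Scope ring_scope.

Lemma kappa_le s t : 0 <= s -> s <= t -> t <= 1 -> kappa s <= kappa t.
Proof. by move=> *; apply: (gauge_nondecr kg); rewrite ?in_itv/=; lra. Qed.

Lemma kappa_ge0 s : 0 <= s <= 1 -> 0 <= kappa s.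
Proof. by case/andP=> s0 s1; rewrite -(gauge0 kg); exact: kappa_le. Qed.

Lemma kappa_concave_ineq (s t u : R) : 0 <= s <= 1 -> 0 <= t <= 1 -> 0 <= u <= 1 ->
  u * kappa s + (1 - u) * kappa t <= kappa (u * s + (1 - u) * t).
Proof.
move=> s01 t01 /andP[u0 u1]; have := @gauge_concave _ _ kg (Itv01 u0 u1) s t.
rewrite !inE/= !in_itv/= => /(_ s01 t01); rewrite !convRE/= /unstable.onem; lra.
Qed.

(** [h'] and [h + g] are convex combinations of [h] and [h' + g] with swapped weights [u] and
    [1 - u]; the two concavity inequalities are added. *)
Lemma kappa_slope h h' g : 0 <= h -> h <= h' -> 0 <= g -> h' + g <= 1 ->
  kappa h + kappa (h' + g) <= kappa h' + kappa (h + g).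
Proof.
(* The denominator of [u] vanishes only if [h = h'] and [g = 0], where both sides coincide. *)
move=> h0 hh' g0 h'g1; have [L0|L0] := leP (h' - h + g) 0.
  have -> : h' = h by lra.
  have -> : g = 0 by lra.
  by rewrite addr0.
set u := g / (h' - h + g).
have uL : u * (h' - h + g) = g by rewrite divfK// gt_eqF.
have u01 : 0 <= u <= 1.
  by rewrite divr_ge0//= ?(ltW L0)// ler_pdivrMr// mul1r; lra.
have := @kappa_concave_ineq h (h' + g) u; have := @kappa_concave_ineq (h' + g) h u.
have -> : u * h + (1 - u) * (h' + g) = h' by lra.
have -> : u * (h' + g) + (1 - u) * h = h + g by lra.
move=> /(_ ltac:(lra) ltac:(lra) ltac:(lra)) i1 /(_ ltac:(lra) ltac:(lra) ltac:(lra)) i2.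
lra.
Qed.

Lemma kappa_incr h h' g g' : 0 <= h -> h <= h' -> 0 <= g -> g <= g' -> h' + g' <= 1 ->
  kappa h + kappa g - kappa (h + g) <= kappa h' + kappa g' - kappa (h' + g').
Proof.
move=> h0 hh' g0 gg' s1; have := @kappa_slope h h' g h0 hh' g0 ltac:(lra).
have := @kappa_slope g g' h' g0 gg' ltac:(lra) ltac:(lra).
rewrite (addrC g' h') (addrC g h'); lra.
Qed.

(** The gaps on both sides of [z] are shorter in the larger set, so [kappa_incr] compares the
    increments; the cases where no gap is split are separate. *)
Lemma gap_entropyU1_anti A B z : B `<=` A ->
  gap_entropy kappa (z |` A) - gap_entropy kappa A
    <= gap_entropy kappa (z |` B) - gap_entropy kappa B.
Proof.
move=> BA; have [zB|zB] := boolP (z \in B).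
  have zA := fsubsetP BA _ zB.
  by rewrite !mem_fset1U// !subrr.
have h1 := gap_before_itv A z; have g1 := gap_after_itv A z.
have h2 := gap_before_itv B z; have g2 := gap_after_itv B z.
have [zA|zA] := boolP (z \in A).
  rewrite (mem_fset1U zA) subrr.
  have [->|B0] := eqVneq B fset0.
    by rewrite fsetU0 gap_entropy1 gap_entropy0 subr0 (gauge1 kg).
  rewrite gap_entropyU1// [leRHS]addrC addKr.
  have := gapD_le1 zB B0 => s1.
  (* Starting from two zero gaps, this says that the increment for [B] is nonnegative. *)
  have := @kappa_incr 0 (gap_before B z) 0 (gap_after B z).
  rewrite addr0 (gauge0 kg) => /(_ ltac:(lra) ltac:(lra) ltac:(lra) ltac:(lra) s1); lra.
have [A0|A0] := eqVneq A fset0.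
  by move: BA; rewrite A0 fsubset0 => /eqP ->.
rewrite (gap_entropyU1 _ zA A0) [leLHS]addrC addKr.
have sA := gapD_le1 zA A0.
(* The first point has no gap to split and contributes [kappa 1 = 1], which dominates any later
   increment. *)
have [->|B0] := eqVneq B fset0.
  rewrite fsetU0 gap_entropy1 gap_entropy0 subr0 (gauge1 kg).
  have : kappa (gap_before A z) <= 1 by rewrite -(gauge1 kg); apply: kappa_le; lra.
  have : kappa (gap_after A z) <= kappa (gap_before A z + gap_after A z).
    by apply: kappa_le; lra.
  lra.
rewrite gap_entropyU1// [leRHS]addrC addKr; apply: kappa_incr; try lra.
- exact: gap_before_anti.
- exact: gap_after_anti.
- exact: gapD_le1.
Qed.

(** The points of [C] are inserted one at a time, each costing no more over [A] than over [B]. *)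
Lemma gap_entropy_submodular A B C : B `<=` A ->
  gap_entropy kappa (A `|` C) + gap_entropy kappa B
    <= gap_entropy kappa A + gap_entropy kappa (B `|` C).
Proof.
elim/finSet_rect: C => C IH BA; have [->|[z zC]] := fset_0Vmem C.
  by rewrite !fsetU0.
have /IH/(_ BA) : C `\ z `<` C by rewrite fproperD1.
rewrite -{3 4}(fsetD1K zC) !(fsetUCA _ [fset z]).
have := @gap_entropyU1_anti (A `|` C `\ z) (B `|` C `\ z) z (fsetSU _ BA); lra.
Qed.

(** Submodularity with [C := A], which makes all the sets but [B] equal to [A]. *)
Lemma gap_entropy_le A B : B `<=` A -> gap_entropy kappa B <= gap_entropy kappa A.
Proof.
move=> BA; have := @gap_entropy_submodular A B A BA.
rewrite fsetUid; have /fsetUidPr -> := BA; lra.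
Qed.

(** By monotonicity the term of the split gap outweighs that of its first piece; the second piece is
    at most [ccw z x] long. *)
Lemma gap_entropyU1_le A z x : x \in A ->
  gap_entropy kappa (z |` A) - gap_entropy kappa A <= kappa (ccw z x).
Proof.
have [zA _|zA xA] := boolP (z \in A).
  by rewrite mem_fset1U// subrr kappa_ge0//; have := ccw_itv z x; lra.
have A0 : A != fset0 by apply/fset0Pn; exists x.
rewrite gap_entropyU1// [leLHS]addrC addKr; have := gapD_le1 zA A0.
have := gap_before_itv A z; have := gap_after_itv A z; have := ccw_itv z x => h1 h2 h3 h4.
have := @kappa_le (gap_after A z) _ ltac:(lra) (gap_after_le z xA) ltac:(lra).
have := @kappa_le (gap_before A z) (gap_before A z + gap_after A z)
  ltac:(lra) ltac:(lra) ltac:(lra); lra.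
Qed.

End submodularity.

(** * Components of the complement of a finite set *)

Section arcs.
Context {R : realType}.
Local Notation T := (circle R).
Implicit Types (x y z : T) (A : {fset T}) (r : R).

Lemma exp2pi_continuous : continuous (@exp2pi R).
Proof.
apply: (@continuous_comp_initial _ _ _ (@set_val _ (@unit_circle R))) => t.
have lin : {for t, continuous (fun t : R => 2 * pi * t)}.
  by apply: cvgM; [exact: cvg_cst|exact: cvg_id].
apply: (@cvg_pair _ _ _ _ (nbhs (cos (2 * pi * t))) (nbhs (sin (2 * pi * t)))).
- exact: (continuous_comp lin (@continuous_cos _ _)).
- exact: (continuous_comp lin (@continuous_sin _ _)).
Qed.

Lemma circle_hausdorff : hausdorff_space T.
Proof.
rewrite open_hausdorff => x y xy.
have : hausdorff_space (R * R)%type by exact: norm_hausdorff.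
rewrite open_hausdorff => /(_ (val x) (val y)).
have vxy : val x != val y by apply: contra xy => /eqP/val_inj ->.
move=> /(_ vxy)[[U V]/= [xU yV] [oU oV UV]].
exists (val @^-1` U, val @^-1` V) => /=.
  by rewrite !inE/= in xU yV *.
split; [by exists U|by exists V|].
by rewrite -preimage_setI (eqP UV) preimage_set0.
Qed.

(** * Open arcs as the components of the complement *)

Definition arc x r : set T := [set y | ccw x y < r].

Lemma arcE x r : r <= 1 -> arc x r = exp2pi @` `]angle x, angle x + r[.
Proof.
move=> r1; apply/seteqP; split => [y xy|_ [t /= + <-]].
  exists (angle x + ccw x y); last exact: exp2pi_ccw.
  by rewrite /= in_itv/=; have := ccw_itv x y; rewrite /arc/= in xy; lra.
rewrite in_itv/= => tI; rewrite /arc/= -[t](subrKC (angle x)) ccw_exp2pi; lra.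
Qed.

Lemma arcC x r : 0 < r -> ~` arc x r = exp2pi @` `[angle x + r, angle x + 1].
Proof.
move=> r0; apply/seteqP; split => [y/= /negP|_ [t /= + <-]].
  rewrite -leNgt => xy; exists (angle x + ccw x y); last exact: exp2pi_ccw.
  by rewrite /= in_itv/=; have := ccw_itv x y; lra.
rewrite in_itv/= => tI; rewrite /arc/= -[t](subrKC (angle x)) ccw_exp2pi; last lra.
by apply/negP; rewrite -leNgt; lra.
Qed.

(** The complement is the image of a compact segment, hence closed. *)
Lemma arc_open x r : 0 < r -> open (arc x r).
Proof.
move=> r0; rewrite -[arc x r]setCK; apply: closed_openC; rewrite arcC//.
apply: compact_closed; first exact: circle_hausdorff.
apply: continuous_compact; last exact: segment_compact.
exact/continuous_subspaceT/exp2pi_continuous.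
Qed.

Lemma arc_connected x r : r <= 1 -> connected (arc x r).
Proof.
move=> r1; rewrite arcE//; apply: connected_continuous_connected.
  exact/connected_intervalP/interval_is_interval.
exact/continuous_subspaceT/exp2pi_continuous.
Qed.

Lemma haar_arc x r : 0 < r <= 1 -> haar (arc x r) = r%:E.
Proof.
move=> r01; have a01 := angle_itv x; rewrite /haar.
have E t : 0 <= t < 1 -> ccw x (exp2pi t) =
    (if angle x < t then t - angle x else t - angle x + 1).
  by move=> t01; rewrite /ccw angle_exp2pi.
have [h|h] := leP (angle x + r) 1.
  rewrite (_ : _ `&` _ = [set` `]angle x, angle x + r[]).
    rewrite lebesgue_measure_itv/= lte_fin; case: ifPn => [_|];
      last by rewrite -leNgt => ?; exfalso; lra.
    by rewrite -EFinB; congr EFin; lra.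
  apply/seteqP; split => t; rewrite /arc/= !in_itv/=.
    by move=> [t01]; rewrite E//; case: ifPn; rewrite -?leNgt; lra.
  move=> tI; have t01 : 0 <= t < 1 by lra.
  by split => //; rewrite E//; case: ifPn; rewrite -?leNgt; lra.
(* The arc passes through angle 0, so its trace on [[0, 1[] consists of two intervals. *)
rewrite (_ : _ `&` _ = [set` `[0, angle x + r - 1[] `|` [set` `]angle x, 1[]).
  rewrite measureU//=; last first.
    by apply/seteqP; split => // t [] /=; rewrite !in_itv/=; lra.
  rewrite !lebesgue_measure_itv/= !lte_fin.
  case: ifPn => [_|];
      last by rewrite -leNgt => ?; exfalso; lra.
  case: ifPn => [_|];
      last by rewrite -leNgt => ?; exfalso; lra.
  by rewrite -!EFinB -EFinD; congr EFin; lra.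
apply/seteqP; split => t; rewrite /arc/= !in_itv/=.
  by move=> [t01]; rewrite E//; case: ifPn; rewrite -?leNgt => ? ?; [right|left]; lra.
move=> tI; have t01 : 0 <= t < 1 by lra.
by split => //; rewrite E//; case: ifPn; rewrite -?leNgt; lra.
Qed.

Lemma arc_gap_nonempty A x : arc x (gap_after A x) !=set0.
Proof.
have := gap_after_itv A x => g; exists (exp2pi (angle x + gap_after A x / 2)).
by rewrite /arc/= ccw_exp2pi; lra.
Qed.

Lemma arc_gap_notin A x y : arc x (gap_after A x) y -> y \notin A.
Proof.
by rewrite /arc/= => h; apply/negP => /(gap_after_le x); rewrite leNgt h.
Qed.

Lemma arc_gap_cover A y : A != fset0 -> y \notin A ->
  exists2 x, x \in A & arc x (gap_after A x) y.
Proof.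
move=> A0 yA; have [p pA h] := gap_beforeP y A0.
exists p => //; rewrite /arc/= (gap_after_pred yA)// ltrDl.
by case/andP: (gap_after_itv A y).
Qed.

(** If [x] is strictly closer to [z] than [y] is, then [x] lies between [y] and [z] and ends the gap
    of [y] before [z]. *)
Lemma arc_gap_disjoint A x y z : x \in A -> y \in A ->
  arc x (gap_after A x) z -> arc y (gap_after A y) z -> x = y.
Proof.
wlog : x y / ccw x z <= ccw y z.
  by move=> h *; case: (leP (ccw x z) (ccw y z)) => [|/ltW] ?; [|apply/esym]; exact: h.
rewrite le_eqVlt => /orP[/eqP/ccw_injl //|/ccw_transl e] xA yA _.
rewrite /arc/= e => h; exfalso; have := gap_after_le y xA.
by have := ccw_itv x z; lra.
Qed.

Lemma connected_component_arc A x y : x \in A -> arc x (gap_after A x) y ->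
  connected_component (~` [set` A]) y = arc x (gap_after A x).
Proof.
move=> xA xy; have g01 := gap_after_itv A x; apply/seteqP; split; last first.
  apply: connected_component_max => //.
    by move=> z /arc_gap_notin /negP.
  by apply: arc_connected; case/andP: g01.
pose C := connected_component (~` [set` A]) y; pose I := arc x (gap_after A x).
have yA : (~` [set` A]) y by apply/negP/(arc_gap_notin xy).
have CA : C `<=` ~` [set` A] := @connected_component_sub _ _ _.
suff CI : C `&` I = C by move=> z Cz; have : C z by []; rewrite -CI => -[].
(* The other gaps cover the rest of the complement of [A]. As [D] is open, [C] meets [I] in a set
   that is both open and closed in [C], hence in all of [C]. *)
pose D := \bigcup_(z in [set` A] `\ x) arc z (gap_after A z).
apply: (@component_connected _ _ _ : connected C).
- by exists y; split; [exact: connected_component_refl|].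
- by exists I => //; apply: arc_open; case/andP: g01.
exists (~` D).
  apply: open_closedC; apply: bigcup_open => z _; apply: arc_open.
  by case/andP: (gap_after_itv A z).
apply/seteqP; split => z [Cz]; [move=> Iz|move=> Dz]; split=> //.
  by move=> [w [/= wA wx] wz]; apply: wx; exact: (arc_gap_disjoint wA xA wz Iz).
have A0 : A != fset0 by apply/fset0Pn; exists x.
have [|w wA wz] := @arc_gap_cover A z A0; first by apply/negP; exact: CA.
have [e|wx] := eqVneq w x; first by rewrite /I -e.
by exfalso; apply: Dz; exists w => //; split => //; exact/eqP.
Qed.

Lemma components_finite A : A != fset0 ->
  components (~` [set` A]) = (fun x => arc x (gap_after A x)) @` [set` A].
Proof.
move=> A0; apply/seteqP; split => [_ [y yA <-]|_ [x xA <-]].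
  have [|x xA xy] := @arc_gap_cover A y A0; first exact/negP.
  by exists x => //; rewrite (connected_component_arc xA xy).
have [y xy] := arc_gap_nonempty A x.
exists y; last exact: connected_component_arc.
exact/negP/(arc_gap_notin xy).
Qed.

Lemma finite_entropyE (kappa : R -> R) A : (forall t, 0 <= t <= 1 -> 0 <= kappa t) ->
  finite_entropy kappa [set` A] = (gap_entropy kappa A)%:E.
Proof.
move=> k0; rewrite /finite_entropy; have [->|A0] := eqVneq A fset0.
  by rewrite set_fset0 eqxx gap_entropy0.
rewrite ifF; last by apply/negbTE/set0P; case/fset0Pn : A0 => x xA; exists x.
rewrite components_finite// esum_image; last first.
  move=> x y /[!inE] xA yA e; have [z xz] := arc_gap_nonempty A x.
  by apply: (arc_gap_disjoint xA yA xz); rewrite -e.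
rewrite esum_fset//; last first.
  by move=> x _; rewrite lee_fin k0// haar_arc ?gap_after_itv//=; have := gap_after_itv A x; lra.
rewrite fsbig_finite//= set_fsetK sumEFin; congr EFin; apply: eq_bigr => x _.
by rewrite haar_arc// gap_after_itv.
Qed.

End arcs.

(** * Entropy of closed sets *)

Section entropy_theory.
Context {R : realType}.
Local Notation T := (circle R).
Variable kappa : R -> R.
Hypothesis kg : gauge kappa.
Implicit Types (x y z : T) (E F : set T) (A B C P : {fset T}).
Local Notation gent := (gap_entropy kappa).
Local Notation entropy := (entropy kappa).
Local Notation carleson := (carleson kappa).

Let kge0 t : 0 <= t <= 1 -> 0 <= kappa t.
Proof. exact: (kappa_ge0 kg). Qed.

Lemma entropy_ub E A : [set` A] `<=` E -> ((gent A)%:E <= entropy E)%E.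
Proof.
move=> AE; apply: ereal_sup_ubound; exists [set` A]; last exact: finite_entropyE.
by split=> //; exact: finite_fset.
Qed.

Lemma entropy_le E (M : \bar R) :
  (forall A, [set` A] `<=` E -> ((gent A)%:E <= M)%E) -> (entropy E <= M)%E.
Proof.
move=> h; apply: ge_ereal_sup => _ [F [/finite_fsetP[A ->] AE] <-].
by rewrite finite_entropyE//; exact: h.
Qed.

Lemma entropy_ge0 E : (0 <= entropy E)%E.
Proof.
by have := @entropy_ub E fset0; rewrite gap_entropy0; apply => x; rewrite /= inE.
Qed.

Lemma entropyS E F : E `<=` F -> (entropy E <= entropy F)%E.
Proof. by move=> EF; apply: entropy_le => A AE; apply: entropy_ub; exact: subset_trans EF. Qed.

Lemma entropy_fset A : entropy [set` A] = (gent A)%:E.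
Proof.
apply/eqP; rewrite eq_le entropy_ub// andbT; apply: entropy_le => B BA.
by rewrite lee_fin; apply: (gap_entropy_le kg); apply/fsubsetP => x /BA.
Qed.

Lemma fset_subsetU A E F : [set` A] `<=` E `|` F ->
  exists B C, [/\ [set` B] `<=` E, [set` C] `<=` F & A = (B `|` C)%fset].
Proof.
move=> AEF; exists [fset x in A | x \in E]%fset, [fset x in A | x \in F]%fset; split.
- by move=> x /=; rewrite !inE/= => /andP[_ /set_mem].
- by move=> x /=; rewrite !inE/= => /andP[_ /set_mem].
apply/fsetP => x; rewrite !inE/= -andb_orr; case: (boolP (x \in A)) => //= xA.
by case: (AEF x xA) => h; apply/esym/orP; [left|right]; exact/mem_set.
Qed.

(** A finite subset of the union splits into [D] in [E], [G] in [F] and points of [P]; finite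
    submodularity compares adding [G] to [D] with [P] and to [P] alone. Since [P] is finite, its
    entropy is a real number and can be subtracted. *)
Lemma entropy_submodular E F P :
  (entropy (E `|` F `|` [set` P]) + (gent P)%:E
    <= entropy (E `|` [set` P]) + entropy (F `|` [set` P]))%E.
Proof.
rewrite -leeBrDr//; apply: entropy_le => A /fset_subsetU[B [C [BEF CP ->]]].
have [D [G [DE GF ->]]] := fset_subsetU BEF.
rewrite leeBrDr// -EFinD.
have DP : [set` (D `|` P)%fset] `<=` E `|` [set` P].
  by move=> x; rewrite /= inE => /orP[/DE|]; [left|right].
have GP : [set` (P `|` G)%fset] `<=` F `|` [set` P].
  by move=> x; rewrite /= inE => /orP[|/GF]; [right|left].
apply: le_trans (leeD (entropy_ub DP) (entropy_ub GP)); rewrite -EFinD lee_fin.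
have := gap_entropy_submodular kg G (fsubsetUr D P); apply: le_trans.
rewrite lerD2r; apply: (gap_entropy_le kg); apply/fsubsetP => x.
rewrite !inE => /orP[/orP[] ->|/CP/= ->]; by rewrite ?orbT.
Qed.

Lemma entropyU E F : (entropy (E `|` F) <= entropy E + entropy F)%E.
Proof.
have := entropy_submodular E F fset0.
by rewrite gap_entropy0 adde0 set_fset0 !setU0.
Qed.

Lemma exp2pi_preimage_closed E : closed E -> closed (exp2pi @^-1` E : set R).
Proof. by move=> cE; apply: closed_comp => // t _; exact: exp2pi_continuous. Qed.

Lemma haar_closed_measurable E : closed E ->
  measurable (`[0, 1[ `&` exp2pi @^-1` E : set (measurableTypeR R)).
Proof.
move=> cE; apply: measurableI; first exact: measurable_itv.
by apply: measurable_realfun.closed_measurable; exact: exp2pi_preimage_closed.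
Qed.

Lemma carlesonS E F : closed E -> E `<=` F -> carleson F -> carleson E.
Proof.
move=> cE EF [cF F0 Foo]; split=> //; last exact: le_lt_trans (entropyS EF) Foo.
rewrite /haar in F0 *.
apply: (subset_measure0 (mu := lebesgue_measure) (haar_closed_measurable cE)
  (haar_closed_measurable cF) _ F0).
by move=> t [? ?]; split=> //; exact: EF.
Qed.

Lemma carlesonU E F : carleson E -> carleson F -> carleson (E `|` F).
Proof.
move=> [cE E0 Eoo] [cF F0 Foo]; split; first exact: closedU.
  rewrite /haar preimage_setU setIUr null_set_setU//; exact: haar_closed_measurable.
by apply: le_lt_trans (entropyU E F) _; exact: lte_add_pinfty.
Qed.

Lemma carleson_fset A : carleson [set` A].
Proof.
split; last by rewrite entropy_fset ltry.
  apply: (iffLR accessible_finite_set_closed); last exact: finite_fset.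
  exact/hausdorff_accessible/circle_hausdorff.
apply: countable_lebesgue_measure0; apply: finite_set_countable.
apply: (sub_finite_set _ (finite_image (@angle R) (finite_fset A))) => t [t01 tA].
by exists (exp2pi t) => //; apply: angle_exp2pi; rewrite /= in_itv/= in t01.
Qed.

Lemma carleson0 : carleson set0.
Proof. by rewrite -set_fset0; exact: carleson_fset. Qed.

Lemma carleson_entropy_fin E : carleson E -> entropy E \is a fin_num.
Proof. by case=> _ _ Eoo; rewrite ge0_fin_numE// entropy_ge0. Qed.

(** * Approximation by roots of unity *)

Definition roots (n : nat) : {fset T} :=
  [fset exp2pi (k%:R / n.+1%:R) | k in iota 1 n.+1]%fset.

Lemma rootsP n x : exists2 y, y \in roots n & ccw x y <= n.+1%:R^-1.
Proof.
have a01 := angle_itv x; have n0 : 0 < n.+1%:R :> R by rewrite ltr0n.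
have key (v w : R) : angle x < v -> v <= angle x + w -> w <= 1 ->
    ccw x (exp2pi v) <= w.
  by move=> v0 v1 w1; rewrite -[v](subrKC (angle x)) ccw_exp2pi; lra.
have /truncn_itv : 0 <= angle x * n.+1%:R by apply: mulr_ge0; lra.
set k := Num.truncn _ => /andP[k1 k2].
(* The first root strictly after [x]; its index lies between 1 and [n.+1], the range used in
   [roots]. *)
exists (exp2pi (k.+1%:R / n.+1%:R)).
  apply/imfsetP; exists k.+1 => //.
  change (k.+1 \in iota 1 n.+1); rewrite mem_iota /= add1n ltnS -(ltr_nat R).
  by apply: le_lt_trans k1 _; rewrite -[ltRHS]mul1r ltr_pM2r//; lra.
have u0 : angle x < k.+1%:R / n.+1%:R by rewrite ltr_pdivlMr.
have u1 : k.+1%:R / n.+1%:R <= angle x + n.+1%:R^-1.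
  by rewrite -natr1 mulrDl mul1r lerD2r ler_pdivrMr.
have n1 : n.+1%:R^-1 <= 1 :> R by rewrite invf_le1// ler1n.
exact: key u0 u1 n1.
Qed.

(** Every inserted point has a root within [n.+1%:R^-1] ahead of it, so it costs at most
    [kappa n.+1%:R^-1]. *)
Lemma gap_entropy_roots A n :
  gent (roots n `|` A)%fset <= gent (roots n) + #|` A|%:R * kappa n.+1%:R^-1.
Proof.
elim/finSet_rect: A => A IH; have [->|[z zA]] := fset_0Vmem A.
  by rewrite fsetU0 cardfs0 mul0r addr0.
have := IH (A `\ z)%fset; rewrite fproperD1 => // /(_ isT).
have [y yP zy] := rootsP n z.
have := @gap_entropyU1_le _ _ kg (roots n `|` A `\ z)%fset z y.
rewrite inE yP => /(_ isT).
have n1 : n.+1%:R^-1 <= 1 :> R by rewrite invf_le1// ler1n.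
have := @kappa_le _ _ kg (ccw z y) n.+1%:R^-1.
have := ccw_itv z y => c01 /(_ ltac:(lra) zy n1).
rewrite fsetUCA fsetD1K// (cardfsD1 z A) zA add1n.
by rewrite -[(#|` _|.+1)%:R]natr1 mulrDl mul1r; lra.
Qed.

Lemma kappa_harmonic_cvg0 (e : R) : 0 < e ->
  \forall n \near \oo, kappa n.+1%:R^-1 < e.
Proof.
move=> e0; move: (gauge_cont kg) => /(continuous_within_itvP _ (@ltr01 R))[_ k0 _].
have := cvgr_lt _ k0 e; rewrite (gauge0 kg) => /(_ _ e0).
rewrite /at_right near_withinE => /nbhs_ballP[d /= d0 h].
near=> n; apply: h; last by rewrite invr_gt0.
rewrite /ball/= sub0r normrN gtr0_norm ?invr_gt0//.
near: n; exact: (near_infty_natSinv_lt (PosNum d0)).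
Unshelve. all: by end_near. Qed.

(** A finite [A] in [F] captures its entropy up to [e / 2]. By submodularity further points of [F]
    cost at most [e / 2] over [A] with the roots, and adding [A] to the roots costs at most [e / 2]
    for large [n]. *)
Lemma entropy_roots_approx F (e : R) : carleson F -> 0 < e ->
  \forall n \near \oo,
    (entropy (F `|` [set` roots n]) <= (gent (roots n) + e)%:E)%E.
Proof.
move=> cF e0; have Ffin := carleson_entropy_fin cF.
have [A AF hA] : exists2 A, [set` A] `<=` F & (entropy F - (e / 2)%:E < (gent A)%:E)%E.
  have e20 : 0 < e / 2 by lra.
  have [_ [G [/finite_fsetP[A ->] AF] <-]] := ub_ereal_sup_adherent e20 Ffin.
  by rewrite finite_entropyE// => h; exists A.
(* The successor keeps the divisor nonzero when [A] is empty. *)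
have d0 : 0 < e / 2 / (#|` A|.+1)%:R by rewrite !divr_gt0.
near=> n; have kn : kappa n.+1%:R^-1 < e / 2 / (#|` A|.+1)%:R.
  by near: n; exact: kappa_harmonic_cvg0.
apply: entropy_le => B /fset_subsetU[C [D [CF DP ->]]].
have := gap_entropy_submodular kg (roots n) (fsubsetUr C A).
have := gap_entropy_roots A n; rewrite fsetUC.
have CA : [set` (C `|` A)%fset] `<=` F by move=> x; rewrite /= inE => /orP[/CF|/AF].
have := entropy_ub CA; rewrite -(fineK Ffin) !lee_fin => h1 h2 h3.
have : gent (C `|` D)%fset <= gent (C `|` A `|` roots n)%fset.
  apply: (gap_entropy_le kg); apply/fsubsetP => x.
  by rewrite !inE => /orP[->|/DP/= ->]; rewrite ?orbT.
move: hA; rewrite -(fineK Ffin) -EFinB lte_fin.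
have : #|` A|%:R * kappa n.+1%:R^-1 <= e / 2.
  have k0 : 0 <= kappa n.+1%:R^-1 by apply: kge0; rewrite invr_ge0 invf_le1// ler1n ler0n.
  have : (#|` A|.+1)%:R * kappa n.+1%:R^-1 <= e / 2.
    by rewrite mulrC -ler_pdivlMr ?ltr0n// ltW.
  by rewrite -natr1; lra.
lra.
Unshelve. all: by end_near. Qed.

End entropy_theory.

(** * Thin measures *)

Section thin_measures.
Context {R : realType}.
Local Notation T := (circle R).
Variable kappa : R -> R.
Hypothesis kg : gauge kappa.
Implicit Types (B D E F : set T) (mu nu : {measure set T -> \bar R}).
Local Notation gent := (gap_entropy kappa).
Local Notation entropy := (entropy kappa).
Local Notation carleson := (carleson kappa).

Lemma borel_open E : open E -> borel E.
Proof. exact: sub_sigma_algebra. Qed.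

Lemma borel_closed E : closed E -> borel E.
Proof.
move=> cE; rewrite -[E]setCK.
by apply: (@measurableC _ T); apply: borel_open; exact: closed_openC.
Qed.

Lemma carleson_borelP B E : borel B -> carleson E -> B `<=` E ->
  carleson_borel kappa B.
Proof.
move=> bB cE BE; split => //; apply: (carlesonS kg _ _ cE).
  exact: closed_closure.
by case: cE => cE _ _; rewrite (iffLR (closure_id E) cE); exact: closureS.
Qed.

Lemma thin_measure_fin mu B E : thin_measure kappa mu -> carleson E -> borel B ->
  B `<=` E -> mu B \is a fin_num.
Proof.
move=> [_ [c c0 muc]] cE bB BE; rewrite ge0_fin_numE//.
have bE : borel E by apply: borel_closed; case: cE.
apply: le_lt_trans (le_measure mu _ _ BE) _; rewrite ?inE//.
apply: le_lt_trans (muc E cE) _.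
have /fineK <- : entropy E \is a fin_num by exact: carleson_entropy_fin.
by rewrite -EFinM ltry.
Qed.

Lemma thin_measure_singular mu : thin_measure kappa mu ->
  pos_singular_measure kappa (fun B => fine (mu B)).
Proof.
move=> tmu; split; last by move=> E B _ _ _; rewrite fine_ge0.
split=> [E cE|].
  split=> [|A bA AE tA]; first by rewrite measure0.
  have bU : borel (\bigcup_n A n) by apply: (@bigcup_measurable _ T) => n _; exact: bA.
  have UE : \bigcup_n A n `<=` E by move=> x [n _ /AE].
  have := @measure_semi_sigma_additive _ _ _ mu A bA tA bU.
  rewrite -{1}(fineK (thin_measure_fin tmu cE bU UE)) => /fine_cvg.
  suff -> : (fun n => \sum_(0 <= i < n) fine (mu (A i))) =
      fine \o (fun n => \sum_(0 <= i < n) mu (A i))%E by [].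
  apply/funext => n /=; rewrite sum_fine// => i _.
  exact: (thin_measure_fin tmu cE (bA i) (AE i)).
have [_ [c c0 muc]] := tmu; exists c => // F cF.
have bF : borel F by apply: borel_closed; case: cF.
by rewrite ger0_norm ?fine_ge0// fineK ?muc// (thin_measure_fin tmu cF).
Qed.

Lemma thin_measure_extends mu : thin_measure kappa mu ->
  extends kappa mu (fun B => fine (mu B)).
Proof.
move=> tmu B [bB cB]; rewrite fineK// (thin_measure_fin tmu cB)//.
exact: subset_closure.
Qed.

(** On [B] cut by the exhausting sets of [nu] both measures equal [sigma], and the limit gives
    [nu B]. Applied in both directions this yields uniqueness. *)
Lemma thin_measure_le mu nu (sigma : set T -> R) : thin_measure kappa nu ->
  extends kappa mu sigma -> extends kappa nu sigma ->
  forall B, borel B -> (nu B <= mu B)%E.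
Proof.
move=> [[F [cF _ nuF]] _] muE nuE B bB.
apply: cvge_le (nuF B bB); apply: nearW => n.
have bF : borel (F n) by apply: borel_closed; case: (cF n).
have bBF : borel (B `&` F n) by exact: (@measurableI _ T).
rewrite nuE -?muE; first by rewrite le_measure ?inE//; exact: subIsetl.
all: exact: (carleson_borelP bBF (cF n) (@subIsetr _ _ _)).
Qed.

(** * Construction of the thin extension *)

Section extension.
Variables (sigma : set T -> R) (c : R).
Hypothesis sigma_measure : forall E, carleson E -> finite_real_measure_on sigma E.
Hypothesis sigma_ge0 : forall E B, carleson E -> borel B -> B `<=` E -> 0 <= sigma B.
Hypothesis c_ge0 : 0 <= c.
Hypothesis sigma_le : forall F, carleson F -> ((sigma F)%:E <= c%:E * entropy F)%E.

Lemma singular0 : sigma set0 = 0.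
Proof. by case: (sigma_measure (carleson0 kg)). Qed.

Lemma singularU E A B : carleson E -> borel A -> borel B -> A `<=` E -> B `<=` E ->
  [disjoint A & B] -> sigma (A `|` B) = sigma A + sigma B.
Proof.
move=> cE bA bB AE BE; rewrite disj_set2E => /eqP AB.
have [_ /(_ (bigcup2 A B))] := sigma_measure cE.
rewrite -bigcup2E.
have b2 n : borel (bigcup2 A B n) by move: n => [|[|n]]//; exact: (@measurable0 _ T).
have E2 n : bigcup2 A B n `<=` E by move: n => [|[|n]].
rewrite trivIset_bigcup2 in AB; move=> /(_ b2 E2 AB) h; apply/esym; apply: (cvg_unique _ _ h) => //.
(* The sets of [bigcup2] are empty from index 2 on, so the partial sums are constant from there. *)
apply: cvg_near_cst; exists 2%N => // -[|[|n]]// _.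
rewrite !big_nat_recl//= big1 ?addr0// => i _; exact: singular0.
Qed.

Lemma singularD E A B : carleson E -> borel A -> borel B -> A `<=` B -> B `<=` E ->
  sigma B = sigma A + sigma (B `\` A).
Proof.
move=> cE bA bB AB BE; rewrite -(@singularU E)//.
- by rewrite setDUK.
- exact: (@measurableD _ T).
- exact: subset_trans BE.
- by move=> x [/BE].
- by rewrite disj_set2E setDIK.
Qed.

Lemma singular_mono E A B : carleson E -> borel A -> borel B -> A `<=` B -> B `<=` E ->
  sigma A <= sigma B.
Proof.
move=> cE bA bB AB BE; rewrite (singularD cE bA bB AB BE) lerDl.
by apply: (sigma_ge0 cE); [exact: (@measurableD _ T)|move=> x [/BE]].
Qed.

Lemma carleson_borel_set F : carleson F -> borel F.
Proof. by case=> cF _ _; exact: borel_closed. Qed.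

(* [U] nearly maximizes [sigma F - c * entropy (F `|` P)], which is nonpositive.
   Comparing the values at [U] and [F `|` U], submodularity cancels the entropy
   of [U]. *)
Lemma singular_almost_carrier (P : {fset T}) (e : R) : 0 < e ->
  exists2 U, carleson U & forall F, carleson F ->
    sigma (F `\` U) <= c * (fine (entropy (F `|` [set` P])) - gent P) + e.
Proof.
move=> e0; pose k F := fine (entropy (F `|` [set` P])).
have cP F : carleson F -> carleson (F `|` [set` P]).
  by move=> cF; apply: (carlesonU kg) => //; exact: carleson_fset.
have kE F : carleson F -> entropy (F `|` [set` P]) = (k F)%:E.
  by move=> /cP cF; rewrite fineK// carleson_entropy_fin.
pose S := [set sigma F - c * k F | F in carleson].
have supS : has_sup S.
  split; first by exists (sigma set0 - c * k set0); exists set0 => //; exact: carleson0.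
  exists 0 => _ [F cF <-]; rewrite subr_le0 -lee_fin EFinM -kE//.
  apply: le_trans (sigma_le cF) _; apply: lee_wpmul2l; rewrite ?lee_fin//.
  by apply: entropyS => //; exact: subsetUl.
have [_ [U cU <-] hU] := sup_adherent e0 supS.
exists U => // F cF; have cFU := carlesonU kg cF cU.
have : sigma (F `|` U) - c * k (F `|` U) <= sup S.
  by apply: sup_upper_bound => //; exists (F `|` U).
have -> : sigma (F `|` U) = sigma U + sigma (F `\` U).
  rewrite (@singularD (F `|` U) U (F `|` U) cFU)//; try exact: carleson_borel_set.
  by rewrite setDUl setDv setU0.
have : k (F `|` U) + gent P <= k F + k U.
  by rewrite -lee_fin !EFinD -!kE//; exact: entropy_submodular.
move=> /(ler_wpM2l c_ge0); rewrite !mulrDr -/(k F) mulrN; lra.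
Qed.

Lemma singular_carrier : exists V : nat -> set T,
  [/\ forall n, carleson (V n), nondecreasing_seq V &
      forall F, carleson F -> sigma (F `\` \bigcup_n V n) = 0].
Proof.
have n0 n : 0 < n.+1%:R^-1 :> R by rewrite invr_gt0.
have /choice[U hU] : forall n, exists U, carleson U /\ forall F, carleson F ->
    sigma (F `\` U) <= c * (fine (entropy (F `|` [set` @roots R n])) - gent (roots n))
      + n.+1%:R^-1.
  by move=> n; have [U] := singular_almost_carrier (roots n) (n0 n); exists U.
(* Finite unions make the sequence increasing and keep it Carleson. *)
pose V n := \big[setU/set0]_(i < n.+1) U i.
have cV n : carleson (V n).
  rewrite /V; elim/big_ind : _ => [|A B cA cB|i _]; first exact: carleson0.
    exact: carlesonU.
  by case: (hU i).
have VU n : U n `<=` V n by rewrite /V big_ord_recr/=; exact: subsetUr.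
exists V; split => //.
  apply/nondecreasing_seqP => n; rewrite subsetEset /V.
  by rewrite [X in _ `<=` X]big_ord_recr/=; exact: subsetUl.
move=> F cF; have bV : borel (\bigcup_n V n).
  by apply: (@bigcup_measurable _ T) => n _; exact: carleson_borel_set.
have bF := carleson_borel_set cF.
have bFV : borel (F `\` \bigcup_n V n) by exact: (@measurableD _ T).
apply/eqP; rewrite eq_le (sigma_ge0 cF bFV (@subDsetl _ _ _)) andbT.
apply/ler_addgt0Pr => e e0; rewrite add0r.
have c1 : 0 < c + 1 by rewrite ltr_wpDl.
(* Dividing by [c + 1] allows [c = 0]; multiplied by [c] this is at most [e / 2], and the other half
   absorbs [n.+1%:R^-1]. *)
have d0 : 0 < e / (c + 1) / 2.
  by rewrite !divr_gt0.
near \oo => n.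
have [cU /(_ F cF) hUF] := hU n.
have h1 : (entropy (F `|` [set` @roots R n]) <= (gent (roots n) + e / (c + 1) / 2)%:E)%E.
  by near: n; exact: entropy_roots_approx.
have h2 : n.+1%:R^-1 < e / 2.
  by near: n; exact: (near_infty_natSinv_lt (PosNum (divr_gt0 e0 (@ltr0Sn R 1)))).
have h3 : sigma (F `\` \bigcup_n V n) <= sigma (F `\` U n).
  apply: (singular_mono cF bFV); last exact: subDsetl.
    by apply: (@measurableD _ T) => //; exact: carleson_borel_set.
  by apply: setDS => x Ux; exists n => //; exact: VU.
apply: (le_trans h3); apply: (le_trans hUF).
have cFP : carleson (F `|` [set` @roots R n]).
  by apply: (carlesonU kg) => //; exact: carleson_fset.
have : c * (fine (entropy (F `|` [set` @roots R n])) - gent (roots n)) <= e / 2.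
  apply: (@le_trans _ _ (c * (e / (c + 1) / 2))).
    apply: ler_wpM2l => //; rewrite lerBlDl.
    by rewrite -lee_fin fineK// carleson_entropy_fin.
  rewrite mulrA ler_pM2r// mulrCA -[leRHS]mulr1 ler_pM2l//.
  by rewrite ler_pdivrMr; lra.
by move=> h4; rewrite [leRHS]splitr; exact: lerD h4 (ltW h2).
Unshelve. all: by end_near. Qed.

(** Cutting with a set inside a Carleson set keeps [sigma] where it is a measure, and gives a
    measure on the whole circle that can be summed. *)
Lemma singular_restr E D : carleson E -> borel D -> D `<=` E ->
  exists m : {measure set T -> \bar R},
    forall B, borel B -> m B = (sigma (B `&` D))%:E.
Proof.
move=> cE bD DE.
(* The absolute value only matters on sets that are not Borel. *)
pose m B : \bar R := `|sigma (B `&` D)|%:E.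
have BD B : borel B -> borel (B `&` D) by move=> bB; exact: (@measurableI _ T).
have BE B : B `&` D `<=` E by move=> x [_ /DE].
have mE B : borel B -> m B = (sigma (B `&` D))%:E.
  by move=> bB; rewrite /m ger0_norm// (sigma_ge0 cE) //; exact: BD.
have m0 : m set0 = 0%E by rewrite /m set0I singular0 normr0.
have m_ge0 B : (0 <= m B)%E by rewrite lee_fin.
have m_add : @semi_sigma_additive _ _ T m.
  move=> A bA tA bU; rewrite mE// setI_bigcupl.
  have [_ /(_ (fun n => A n `&` D))] := sigma_measure cE.
  move=> /(_ (fun n => BD _ (bA n)) (fun n => BE _) (trivIset_setIr tA)) h.
  suff -> : (fun n => \sum_(0 <= i < n) m (A i))%E =
      EFin \o (fun n => \sum_(0 <= i < n) sigma (A i `&` D)).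
    by apply: cvg_EFin h; apply: nearW.
  by apply/funext => n /=; rewrite -sumEFin; apply: eq_bigr => i _; exact: (mE _ (bA i)).
pose mm := isMeasure.Build _ T R m m0 m_ge0 m_add.
pose M : {measure set T -> \bar R} := HB.pack m mm.
by exists M.
Qed.

Lemma singular_extension : exists mu : {measure set T -> \bar R},
  thin_measure kappa mu /\ extends kappa mu sigma.
Proof.
have [V [cV ndV sV]] := singular_carrier.
have bV n : borel (V n) by exact: carleson_borel_set.
have bUV : borel (\bigcup_n V n) by apply: (@bigcup_measurable _ T) => n _; exact: bV.
have bD n : borel (seqD V n) by case: n => [|n]; [exact: bV|apply: (@measurableD _ T); exact: bV].
have DV n : seqD V n `<=` V n by case: n => [//|n] x [].
have /choice[m mE] := fun n => singular_restr (cV n) (bD n) (@DV n).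
(* The sets [seqD V n] are disjoint, have the same union as the [V n], and each lies in a Carleson
   set. *)
pose mu : {measure set T -> \bar R} := mseries m 0.
have muE B F : borel B -> carleson F -> B `<=` F -> mu B = (sigma B)%:E.
  move=> bB cF BF; have bF := carleson_borel_set cF.
  have bBV : borel (B `&` \bigcup_n V n) by exact: (@measurableI _ T).
  (* The part of [B] off the carrier lies in the null set [F] minus the union of the [V n]. *)
  have -> : sigma B = sigma (B `&` \bigcup_n V n).
    rewrite (@singularD F (B `&` \bigcup_n V n) B)//.
    rewrite setDIr setDv set0U.
    suff -> : sigma (B `\` \bigcup_n V n) = 0 by rewrite addr0.
    have bBV' : borel (B `\` \bigcup_n V n) by exact: (@measurableD _ T).
    apply/eqP; rewrite eq_le (sigma_ge0 cF bBV')// ?andbT; last by move=> x [/BF].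
    rewrite -(sV F cF); apply: (singular_mono cF bBV'); first exact: (@measurableD _ T).
      exact: setSD.
    exact: subDsetl.
  have [_ /(_ (fun n => B `&` seqD V n))] := sigma_measure cF.
  have b n : borel (B `&` seqD V n) by apply: (@measurableI _ T) => //; exact: bD.
  have BDF n : B `&` seqD V n `<=` F by move=> x [/BF].
  move=> /(_ b BDF (trivIset_setIl (trivIset_seqD ndV))).
  rewrite -setI_bigcupr eq_bigcup_seqD => h.
  rewrite /mu/= /mseries; apply: cvg_lim => //.
  suff -> : (fun n => \sum_(0 <= i < n) m i B)%E =
      EFin \o (fun n => \sum_(0 <= i < n) sigma (B `&` seqD V i)).
    by apply: cvg_EFin h; apply: nearW.
  by apply/funext => n /=; rewrite -sumEFin; apply: eq_bigr => i _; exact: (mE i _ bB).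
exists mu; split; last first.
  by move=> B [bB cB]; apply: (muE B _ bB cB); exact: subset_closure.
split; last first.
  by exists c => // F cF; rewrite (muE F F)//; [exact: sigma_le|exact: carleson_borel_set].
exists V; split => //.
  by move=> n; apply/subsetPset; exact: ndV.
move=> B bB.
(* Every summand of [mu] lives on some [V n], so [mu] vanishes off their union; continuity from
   below then gives the limit. *)
have -> : mu B = mu (\bigcup_n (B `&` V n)).
  rewrite -setI_bigcupr (measureDI mu bB bUV).
  rewrite -[RHS]add0e; congr (_ + _)%E.
  rewrite /mu/= /mseries eseries0// => n _ _.
  rewrite mE; last exact: (@measurableD _ T).
  rewrite (_ : _ `&` _ = set0) ?singular0//.
  by apply/seteqP; split => // x [[_ nV] /DV Vx]; apply: nV; exists n.
apply: nondecreasing_cvg_mu => //.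
- by move=> n; apply: (@measurableI _ T) => //; exact: bV.
- by apply: (@bigcup_measurable _ T) => n _; apply: (@measurableI _ T) => //; exact: bV.
- by move=> i j ij; apply/subsetPset; apply: setIS; apply/subsetPset; exact: ndV.
Qed.

End extension.
End thin_measures.

(** * Extension, uniqueness, finiteness and restriction *)

Unset Implicit Arguments.
Set Strict Implicit.

Theorem theorem37 (R : realType) (kappa : R -> R)
  (kappa_cont : {within `[0, 1], continuous kappa})
  (kappa_nondecr : {in `[0, 1] &, {homo kappa : x y / x <= y}})
  (kappa_concave :
     convex_function (`[0, 1]%classic : set R^o) (fun x => - kappa x))
  (kappa0 : kappa 0 = 0) (kappa1 : kappa 1 = 1) :
  (forall sigma : set (circle R) -> R, pos_singular_measure kappa sigma ->
     exists mu : {measure set (circle R) -> \bar R},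
       [/\ thin_measure kappa mu /\ extends kappa mu sigma,
           forall nu : {measure set (circle R) -> \bar R},
             thin_measure kappa nu -> extends kappa nu sigma ->
             forall B, borel B -> nu B = mu B,
           (mu setT < +oo)%E <->
             exists2 c : R, 0 <= c &
               forall F, carleson kappa F -> sigma F <= c
         & forall c : R, 0 <= c ->
             (forall F, carleson kappa F -> sigma F <= c) ->
             (mu setT <= c%:E)%E]) /\
  (forall mu : {measure set (circle R) -> \bar R}, thin_measure kappa mu ->
     extends kappa mu (fun B => fine (mu B)) /\
     pos_singular_measure kappa (fun B => fine (mu B))).
Proof.
have kg : gauge kappa by [].
split; last by move=> mu tmu; split; [exact: thin_measure_extends|exact: thin_measure_singular].
move=> sigma [[sigma_measure [c c0 sigma_le]] sigma_ge0].
have [|mu [tmu muE]] := singular_extension kg sigma_measure sigma_ge0 c0.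
  by move=> F cF; apply: le_trans (sigma_le F cF); rewrite lee_fin ler_norm.
have muF F : carleson kappa F -> mu F = (sigma F)%:E.
  by move=> cF; apply: muE; exact: (carleson_borelP kg (carleson_borel_set cF) cF).
(* The total mass is the limit of [mu (F n) = sigma (F n)] along the exhausting Carleson sets. This
   serves both the finiteness criterion and the final bound. *)
have bound c' : (forall F, carleson kappa F -> sigma F <= c') -> (mu setT <= c'%:E)%E.
  move=> h; have [[F [cF _ cvF]] _] := tmu.
  have bT : borel [set: circle R] by exact: (@measurableT _ (circle R)).
  apply: cvge_le (cvF _ bT); apply: nearW => n.
  by rewrite setTI muF// lee_fin h.
exists mu; split => //.
- move=> nu tnu nuE B bB; apply/eqP; rewrite eq_le.
  by rewrite (thin_measure_le kg tnu muE nuE)// (thin_measure_le kg tmu nuE muE).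
- split=> [muT|[c' _ h]]; last by apply: le_lt_trans (bound c' h) _; exact: ltry.
  have fT : mu setT \is a fin_num by rewrite ge0_fin_numE.
  exists (fine (mu setT)); first exact: fine_ge0.
  move=> F cF; have bF := carleson_borel_set cF.
  by rewrite -lee_fin -muF// fineK// le_measure ?inE//; exact: (@measurableT _ (circle R)).
- by move=> c' _; exact: bound.
Qed.
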